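(* Let $G$ be a distance-regular graph with $n$ vertices, diameter $3$, intersection array $\{k,b_1,b_2;1,c_2,c_3\}$ and distinct adjacency eigenvalues $k>\theta_1>\theta_2>\theta_3$, and put $a_3=k-c_3$. Then $G$ has exactly $3$ distinct distance eigenvalues if and only if $\theta=c_2+a_3-b_2$ is a non-trivial eigenvalue of $G$, i.e. $c_2+a_3-b_2\in\{\theta_1,\theta_2,\theta_3\}$.
   Context: Graphs are finite, undirected and simple. A connected graph $G$ of diameter $D$ is distance-regular if there are numbers $a_i,b_i,c_i$ ($0\le i\le D$) such that for all vertices $x,y$ with $d(x,y)=i$, the number of neighbours of $y$ at distance $i-1$, $i$, $i+1$ from $x$ is $c_i$, $a_i$, $b_i$ respectively; $k=b_0$ is the valency, $c_0=b_D=0$, $a_i+b_i+c_i=k$, and $\{b_0,\dots,b_{D-1};c_1=1,c_2,\dots,c_D\}$ is the intersection array. The distance eigenvalues of $G$ are the eigenvalues of its distance matrix, whose $(x,y)$-entry is $d(x,y)$. *)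

(* Defs.v *)
From mathcomp Require Import all_boot all_order all_algebra.

Set Implicit Arguments.
Unset Strict Implicit.
Unset Printing Implicit Defensive.

Import Order.TTheory GRing.Theory Num.Theory.

(* A finite simple graph is a symmetric irreflexive relation e on a finType. *)

Definition connected (V : finType) (e : rel V) : Prop :=
  forall x y : V, connect e x y.

Definition has_walk (V : finType) (e : rel V) (m : nat) (x y : V) : bool :=
  [exists p : m.-tuple V, path e x p && (last x p == y)].

(* A shortest walk has length < #|V|, so this is the length of a shortest     *)
(* walk; it takes the junk value #|V| when y is not reachable from x.         *)
Definition dist (V : finType) (e : rel V) (x y : V) : nat :=
  find (fun m => has_walk e m x y) (iota 0 #|V|).

Definition diameter (V : finType) (e : rel V) : nat :=
  \max_(x : V) \max_(y : V) dist e x y.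

(* "At distance i - 1" is written with a successor to avoid truncated         *)
(* subtraction, so that c 0 = 0.                                              *)
Definition intersection_numbers (V : finType) (e : rel V)
    (a b c : nat -> nat) : Prop :=
  forall (i : nat) (x y : V), dist e x y = i ->
    [/\ #|[set z | e y z & (dist e x z).+1 == i]| = c i,
        #|[set z | e y z & dist e x z == i]| = a i
      & #|[set z | e y z & dist e x z == i.+1]| = b i].

Definition distance_regular (V : finType) (e : rel V) : Prop :=
  connected e /\ exists a b c : nat -> nat, intersection_numbers e a b c.

Definition intersection_array (V : finType) (e : rel V)
    (bs cs : seq nat) : Prop :=
  exists a b c : nat -> nat,
    [/\ intersection_numbers e a b c,
        bs = mkseq b (diameter e)
      & cs = mkseq (fun i => c i.+1) (diameter e)].

Local Open Scope ring_scope.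

Definition adjacency_mx (R : nzRingType) (V : finType) (e : rel V) :
    'M[R]_#|V| :=
  \matrix_(i, j) (e (enum_val i) (enum_val j))%:R.

Definition distance_mx (R : nzRingType) (V : finType) (e : rel V) :
    'M[R]_#|V| :=
  \matrix_(i, j) (dist e (enum_val i) (enum_val j))%:R.

Definition num_distinct_eigenvalues (F : fieldType) (n : nat) (M : 'M[F]_n)
    (m : nat) : Prop :=
  exists s : seq F,
    [/\ uniq s, size s = m & forall x : F, eigenvalue M x = (x \in s)].

(* Main.v *)
Require Import Defs.
From mathcomp Require Import all_boot all_order all_algebra.
From mathcomp Require Import zify ring lra.

(** Let A be the adjacency matrix and A_i the 0-1 matrix of the relation
    d(x,y) = i.  Counting neighbours by their distance gives the three-term recurrence
    A_i A = c_(i+1) A_(i+1) + a_i A_i + b_(i-1) A_(i-1)  (dist_class_mxMA),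
    which for diameter 3 closes up at i = 3.  So every A_i is a polynomial in
    A, the distance matrix D = A + 2 A_2 + 3 A_3 is q(A) for an explicit
    cubic q (distpoly), and A is annihilated by a monic quartic (intpoly4).

    As A has the four distinct eigenvalues k, theta_i, this quartic is the
    product of the X - z over them.  Its cubic coefficient gives
    theta_1 + theta_2 + theta_3 = a_1 + a_2 + a_3 - k, and its splitting into
    linear factors gives by a Bezout argument that the eigenvalues of D are
    exactly the q(z) (eigenvalue_horner_mx, three_class_spectrum).

    Because A_0 + A_1 + A_2 + A_3 vanishes on the nontrivial eigenspaces, q
    agrees there with the quadratic -3 - 2 z - (z^2 - a_1 z - k) / c_2.  Hence
    q(theta_i) = q(theta_j) for i <> j means theta_i + theta_j = a_1 - 2 c_2
    (distpoly_eq); by the sum formula and k = c_2 + a_2 + b_2 this says that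
    the remaining theta equals c_2 + a_3 - b_2.  That can happen for one pair
    only, since the theta's are distinct.  Finally q(k) differs from the other
    values: off its diagonal D is positive, so its eigenvectors for the
    constant column sum q(k) are constant (Perron_constant).  Thus D has 3
    distinct eigenvalues when such a pair exists, and 4 otherwise. *)

Import Order.TTheory GRing.Theory Num.Theory.
Local Open Scope ring_scope.

Set Implicit Arguments.
Unset Strict Implicit.
Unset Printing Implicit Defensive.

(** * The distance function of a connected graph *)

Section Dist.
Local Open Scope nat_scope.
Variables (V : finType) (e : rel V).

Lemma dist_le m x y : has_walk e m x y -> dist e x y <= m.
Proof.
move=> w; rewrite leqNgt; apply/negP=> lt_m.
have := before_find 0 lt_m; rewrite nth_iota ?w //.
by apply: leq_trans lt_m _; rewrite -[X in _ <= X](size_iota 0) find_size.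
Qed.

(** A path without repeated vertices has fewer than #|V| edges, so in a
    connected graph the search that defines the distance succeeds. *)
Lemma dist_walk x y : connected e -> has_walk e (dist e x y) x y.
Proof.
move=> /(_ x y)/connectP[p]; case/shortenP=> q eq q_uniq _ ->.
have q_lt : size q < #|V|.
  by have := card_uniqP q_uniq; rewrite /= => <-; apply: max_card.
set y' := last x q.
have hs : has (fun m => has_walk e m x y') (iota 0 #|V|).
  apply/hasP; exists (size q); first by rewrite mem_iota.
  by apply/existsP; exists (in_tuple q); rewrite eq /=.
have := nth_find 0 hs; rewrite nth_iota //.
by rewrite -[X in _ < X](size_iota 0) -has_find.
Qed.

Hypothesis e_conn : connected e.

Lemma dist_step x y z : e y z -> dist e x z <= (dist e x y).+1.
Proof.
move=> yz; have /existsP[p /andP[ep /eqP py]] := dist_walk x y e_conn.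
apply: dist_le; apply/existsP; exists [tuple of rcons p z].
by rewrite /= rcons_path ep py yz last_rcons /=.
Qed.

(** The vertex before y on a shortest walk from x to y. *)
Lemma dist_pred i x y : dist e x y = i.+1 -> exists2 z, e z y & dist e x z = i.
Proof.
move=> xy; have := dist_walk x y e_conn; rewrite xy => /existsP[[p /= /eqP p_size]].
case/lastP: p p_size => // p z; rewrite size_rcons last_rcons rcons_path.
move=> [p_size] /andP[/andP[ep pz] /eqP zy]; subst z.
exists (last x p) => //; apply/eqP; rewrite eqn_leq -[i <= _]ltnS -xy dist_step // andbT.
by apply: dist_le; apply/existsP; exists (Tuple (introT eqP p_size)); rewrite /= ep /=.
Qed.

Lemma dist_eq0 x y : (dist e x y == 0) = (x == y).
Proof.
apply/eqP/eqP=> [xy | <-].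
  have := dist_walk x y e_conn; rewrite xy => /existsP[p].
  by rewrite (tuple0 p) => /andP[_ /eqP].
apply/eqP; rewrite -leqn0; apply: dist_le.
by apply/existsP; exists [tuple]; rewrite /=.
Qed.

Lemma dist_eq1 x y : irreflexive e -> (dist e x y == 1) = e x y.
Proof.
move=> e_irr; apply/eqP/idP=> [/dist_pred[z zy /eqP]|xy].
  by rewrite dist_eq0 => /eqP->.
apply/eqP; rewrite eqn_leq; apply/andP; split.
  by apply: leq_trans (dist_step _ xy) _; rewrite (eqP (_ : dist e x x == 0)) // dist_eq0.
by rewrite lt0n dist_eq0; apply: contraTneq xy => ->; rewrite e_irr.
Qed.

Lemma dist_le_diameter x y : dist e x y <= diameter e.
Proof.
apply: leq_trans (leq_bigmax_cond _ (_ : xpredT x)) => //.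
exact: (leq_bigmax_cond (F := dist e x)).
Qed.

(** Walking back along a geodesic between two vertices at maximal distance
    meets every smaller distance.  In a graph of diameter 0 there may be no
    vertex at all, whence the first hypothesis. *)
Lemma dist_attained i : 0 < diameter e -> i <= diameter e ->
  exists x y, dist e x y = i.
Proof.
move=> d_gt0 i_le.
have [x [y xy]] : exists x y, dist e x y = diameter e.
  have V_gt0 : 0 < #|V|.
    rewrite lt0n; apply: contraTneq d_gt0 => V0; rewrite /diameter big1 // => x.
    by have := fintype0 x V0.
  have [x dx] := bigop.eq_bigmax (fun x => \max_y dist e x y) V_gt0.
  have [y dy] := bigop.eq_bigmax (dist e x) V_gt0.
  by exists x, y; rewrite -dy -dx.
exists x; rewrite -(subKn i_le); elim: (diameter e - i) => [|j [z xz]].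
  by rewrite subn0; exists y.
have [lt_j|ge_j] := ltnP j (diameter e); last first.
  exists z; rewrite xz; lia.
have [|t _ xt] := @dist_pred (diameter e - j.+1) x z; first by rewrite xz; lia.
by exists t.
Qed.
End Dist.

(** * Intersection numbers and the recurrence of the distance matrices *)

Section IntersectionNumbers.
Local Open Scope nat_scope.
Variables (V : finType) (e : rel V) (a b c : nat -> nat).
Hypotheses (e_sym : symmetric e) (e_irr : irreflexive e) (e_conn : connected e)
  (abc : intersection_numbers e a b c).

Lemma valencyE y : #|[set z | e y z]| = b 0.
Proof.
have yy : dist e y y = 0 by apply/eqP; rewrite dist_eq0.
have [_ _ <-] := abc yy; apply: eq_card => z; rewrite !inE dist_eq1 //.
by rewrite andbb.
Qed.

(** By the triangle inequality every neighbour of y is at distance i - 1, i or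
    i + 1 from x, and y has b_0 neighbours. *)
Lemma intersection_sum i x y : dist e x y = i -> c i + a i + b i = b 0.
Proof.
move=> xy; have [<- <- <-] := abc xy; rewrite -(valencyE y).
rewrite -cardsUI [#|_ :&: _|](_ : _ = 0) ?addn0; last first.
  by apply/eqP; rewrite cards_eq0; apply/eqP/setP=> z; rewrite !inE; lia.
rewrite -cardsUI [#|_ :&: _|](_ : _ = 0) ?addn0; last first.
  by apply/eqP; rewrite cards_eq0; apply/eqP/setP=> z; rewrite !inE; lia.
apply: eq_card => z; rewrite !inE.
case yz: (e y z) => //=; have := dist_step e_conn x yz.
have zy : e z y by rewrite e_sym.
have := dist_step e_conn x zy; rewrite xy; lia.
Qed.

Lemma c_gt0 i x y : dist e x y = i.+1 -> 0 < c i.+1.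
Proof.
move=> xy; have [<- _ _] := abc xy; have [z zy xz] := dist_pred e_conn xy.
by rewrite card_gt0; apply/set0Pn; exists z; rewrite inE e_sym zy xz /=.
Qed.

Lemma b_diameter x y : dist e x y = diameter e -> b (diameter e) = 0.
Proof.
move=> xy; have [_ _ <-] := abc xy; apply/eqP; rewrite cards_eq0.
apply/eqP/setP=> z; rewrite !inE; have := dist_le_diameter e x z; case: (e y z); lia.
Qed.

Local Open Scope ring_scope.

Definition dist_class_mx (R : nzRingType) (i : nat) : 'M[R]_#|V| :=
  \matrix_(s, t) (dist e (enum_val s) (enum_val t) == i)%:R.

Variable R : comNzRingType.
Local Notation A := (adjacency_mx R e).
Local Notation A_ i := (dist_class_mx R i).

(** Turns matrix products over the index type of the vertices into
    cardinalities of vertex sets, the form in which intersection numbers are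
    given. *)
Lemma sum_enum_val (P : pred V) :
  \sum_(s < #|V|) (P (enum_val s))%:R = #|[set z | P z]|%:R :> R.
Proof.
rewrite -[in RHS]sum1dep_card natr_sum [RHS]big_mkcond /=.
rewrite [RHS](reindex_onto enum_val enum_rank) => [|z _]; last exact: enum_rankK.
by apply: eq_big => [s | s _]; [rewrite enum_valK eqxx | case: ifP].
Qed.

Lemma dist_class_mx0 : A_ 0 = 1%:M.
Proof.
by apply/matrixP=> s t; rewrite !mxE dist_eq0 // (inj_eq enum_val_inj).
Qed.

Lemma dist_class_mx1 : A_ 1 = A.
Proof. by apply/matrixP=> s t; rewrite !mxE dist_eq1. Qed.

Lemma dist_class_mx_gt_diameter i : (diameter e < i)%N -> A_ i = 0.
Proof.
move=> lt_i; apply/matrixP=> s t; rewrite !mxE ltn_eqF //.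
by apply: leq_ltn_trans lt_i; apply: dist_le_diameter.
Qed.

(** The (x, y) entry on the left counts the neighbours of y at distance i from
    x.  When d(x, y) is i + 1, i or i - 1 this is an intersection number for
    the pair, and otherwise there are no such neighbours. *)
Lemma dist_class_mxMA i :
  A_ i *m A = (c i.+1)%:R *: A_ i.+1 + (a i)%:R *: A_ i
              + (if i is j.+1 then (b j)%:R *: A_ j else 0).
Proof.
(* In this form the last term needs no case distinction on i: no distance has
   successor 0. *)
have -> : (if i is j.+1 then (b j)%:R *: A_ j else 0)
    = (b i.-1)%:R *: \matrix_(s, t) ((dist e (enum_val s) (enum_val t)).+1 == i)%:R.
  case: i => [|j]; last by congr (_ *: _); apply/matrixP => s t; rewrite !mxE.
  by apply/matrixP => s t; rewrite !mxE mulr0.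
apply/matrixP=> s t; rewrite !mxE.
set x := enum_val s; set y := enum_val t.
transitivity (#|[set z | e y z & dist e x z == i]|%:R : R).
  rewrite -sum_enum_val; apply: eq_bigr => j _.
  by rewrite !mxE -natrM mulnb andbC e_sym.
have [cE aE bE] := abc (erefl (dist e x y)).
have [xyi|nxyi] := eqVneq (dist e x y) i.
  have -> : (dist e x y == i.+1) = false by lia.
  have -> : ((dist e x y).+1 == i) = false by lia.
  by rewrite -xyi aE mulr1 !mulr0 add0r addr0.
have [xyi|nxyi'] := eqVneq (dist e x y) i.+1.
  have -> : ((dist e x y).+1 == i) = false by lia.
  rewrite !mulr0 !addr0 mulr1 -xyi -cE; congr (_%:R).
  by apply: eq_card => z; rewrite !inE xyi eqSS.
have [xyi|nxyi''] := eqVneq (dist e x y).+1 i.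
  by rewrite !mulr0 !add0r mulr1 -xyi /= -bE.
rewrite !mulr0 !addr0 (_ : #|_| = 0)%N //; apply/eqP.
rewrite cards_eq0; apply/eqP/setP=> z; rewrite !inE; apply/negbTE/andP=> -[yz].
have zy : e z y by rewrite e_sym.
have := dist_step e_conn x yz; have := dist_step e_conn x zy; lia.
Qed.

Lemma const_mxMA : const_mx 1 *m A = (b 0)%:R *: const_mx 1 :> 'rV[R]_#|V|.
Proof.
apply/rowP=> t; rewrite !mxE mulr1 -(valencyE (enum_val t)) -sum_enum_val.
by apply: eq_bigr => s _; rewrite !mxE mul1r e_sym.
Qed.

Lemma distance_mxE : diameter e = 3%N ->
  distance_mx R e = A + 2 *: A_ 2 + 3 *: A_ 3.
Proof.
move=> d3; rewrite -dist_class_mx1; apply/matrixP=> s t; rewrite !mxE.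
have := dist_le_diameter e (enum_val s) (enum_val t); rewrite d3.
by case: (dist _ _ _) => [|[|[|[|//]]]] _ /=; rewrite ?mulr0 ?mulr1 ?add0r ?addr0.
Qed.
End IntersectionNumbers.

(** * Linear algebra *)

Lemma mulmx_horner_eigen (F : fieldType) (n : nat) (A : 'M[F]_n.+1)
    (v : 'rV_n.+1) (z : F) (q : {poly F}) :
  v *m A = z *: v -> v *m horner_mx A q = q.[z] *: v.
Proof.
move=> vA; have /factor_theorem[r qE] : root (q - q.[z]%:P) z.
  by rewrite rootE !hornerE subrr.
rewrite -[q in horner_mx _ q](subrK q.[z]%:P) qE [r * _]mulrC rmorphD rmorphM /=.
rewrite rmorphB /= horner_mx_X !horner_mx_C mulmxDr mulmxA mulmxBr vA.
by rewrite !mul_mx_scalar subrr mul0mx add0r.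
Qed.

(** If x is none of the q(z), then q - x is coprime to the annihilating
    polynomial, so q(A) - x is invertible by Bezout and x is not an
    eigenvalue of q(A). *)
Lemma eigenvalue_horner_mx (F : fieldType) (n : nat) (A : 'M[F]_n.+1)
    (q : {poly F}) (s : seq F) :
    horner_mx A (\prod_(z <- s) ('X - z%:P)) = 0 ->
    {in s, forall z, eigenvalue A z} ->
  forall x, eigenvalue (horner_mx A q) x = (x \in [seq q.[z] | z <- s]).
Proof.
move=> sA0 sP x; apply/idP/mapP => [/eigenvalueP[v vq v0] | [z zs ->]]; last first.
  have /eigenvalueP[v vA v0] := sP _ zs.
  by apply/eigenvalueP; exists v => //; apply: mulmx_horner_eigen.
have [/hasP[z zs /eqP xE] | xs] := boolP (has (fun z => q.[z] == x) s).
  by exists z.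
have cop : coprimep (q - x%:P) (\prod_(z <- s) ('X - z%:P)).
  elim: s xs {sA0 sP} => [|z s IHs] /=; first by rewrite big_nil coprimep1.
  rewrite big_cons coprimepMr coprimep_XsubC rootE !hornerE subr_eq0 negb_or.
  by case/andP=> -> /IHs.
have /Bezout_eq1_coprimepP[[u w] /= uw] := cop.
have /(congr1 (horner_mx A)) := uw.
rewrite [u * _]mulrC rmorphD !rmorphM /= sA0 mulr0 addr0 rmorphB rmorph1 /= horner_mx_C.
move/(congr1 (mulmx v)); rewrite mulmxA mulmxBr vq mul_mx_scalar subrr mul0mx.
by rewrite mulmx1 => v00; rewrite -v00 eqxx in v0.
Qed.

(** A monic quartic with four distinct roots has no other factor; the cubic
    coefficient is then minus the sum of the roots. *)
Lemma monic_quartic_roots (F : fieldType) (e0 e1 e2 e3 : F) (s : seq F) :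
    uniq s -> size s = 4%N -> all (root (Poly [:: e0; e1; e2; e3; 1])) s ->
  Poly [:: e0; e1; e2; e3; 1] = \prod_(z <- s) ('X - z%:P)
    /\ \sum_(z <- s) z = - e3.
Proof.
move=> s_uniq s_size s_root.
have PE : Poly [:: e0; e1; e2; e3; 1] = [:: e0; e1; e2; e3; 1] :> seq F.
  by apply: (@PolyK _ 0); rewrite oner_eq0.
have prodE : Poly [:: e0; e1; e2; e3; 1] = \prod_(z <- s) ('X - z%:P).
  rewrite {1}(@all_roots_prod_XsubC _ (Poly [:: e0; e1; e2; e3; 1]) s).
  - by rewrite lead_coefE PE /= scale1r.
  - by rewrite PE s_size.
  - exact: s_root.
  - by rewrite uniq_rootsE.
split=> //; have := @coefPn_prod_XsubC _ s; rewrite s_size -prodE PE /=.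
by move=> /(_ isT) ->; rewrite opprK.
Qed.

Lemma num_distinct_undup (F : eqType) (P : pred F) (s : seq F) (m : nat) :
    (forall x, P x = (x \in s)) ->
  (exists t, [/\ uniq t, size t = m & forall x, P x = (x \in t)])
    <-> size (undup s) = m.
Proof.
move=> Ps; split=> [[t [t_uniq <- tP]] | sm].
  apply/eqP; rewrite -(uniq_size_uniq t_uniq) ?undup_uniq // => x.
  by rewrite mem_undup -Ps tP.
by exists (undup s); rewrite undup_uniq sm; split=> // x; rewrite mem_undup Ps.
Qed.

(** Perron's simplicity of the leading eigenvalue, by the maximum principle: at
    an index m where v is maximal, the equation v M = w v reads
    sum_j (v_m - v_j) M_jm = 0, as w is also the sum of column m.  All terms
    are nonnegative, so they vanish, and M_jm > 0 for j <> m. *)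
Lemma Perron_constant (R : realFieldType) (n : nat) (M : 'M[R]_n) (w : R)
    (v : 'rV_n) :
    (forall i j, i != j -> 0 < M i j) ->
    const_mx 1 *m M = w *: const_mx 1 :> 'rV_n ->
    v *m M = w *: v ->
  exists r, v = r *: const_mx 1.
Proof.
case: n M v => [|n] M v Mpos Mw vM; first by exists 0; apply/rowP; case.
pose m := [arg max_(j > ord0) v 0 j]%O; exists (v 0 m).
have vle j : v 0 j <= v 0 m.
  by rewrite /m; case: arg_maxP => // i _; apply.
have colw : \sum_j M j m = w.
  have /rowP/(_ m) := Mw; rewrite !mxE mulr1 => <-.
  by apply: eq_bigr => j _; rewrite mxE mul1r.
have : \sum_j (v 0 m - v 0 j) * M j m = 0.
  under eq_bigr => j _ do rewrite mulrBl.
  have /rowP/(_ m) := vM; rewrite !mxE sumrB -mulr_sumr colw => ->.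
  by rewrite mulrC subrr.
move=> /psumr_eq0P sum0; apply/rowP => j; rewrite !mxE mulr1.
have [-> // | jm] := eqVneq j m.
have Mjm := Mpos _ _ jm.
have /eqP : (v 0 m - v 0 j) * M j m = 0.
  apply: sum0 => // i _; have [-> | im] := eqVneq i m; first by rewrite subrr mul0r.
  by rewrite mulr_ge0 ?subr_ge0 // ltW // Mpos.
by rewrite mulf_eq0 subr_eq0 (gt_eqF Mjm) orbF => /eqP.
Qed.

(** * The polynomials of a distance-regular graph of diameter 3 *)

Section ThreeClass.
Variables (F : fieldType) (k a1 b1 c2 a2 b2 c3 a3 : F).

(** The monic polynomials of the recurrence: at A they take the values c2 A_2,
    c2 c3 A_3 and 0.  Clearing the denominators c2 and c3 makes intpoly4 monic,
    so that its roots determine it. *)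
Definition intpoly2 : {poly F} := 'X^2 - a1 *: 'X - k%:P.
Definition intpoly3 : {poly F} := ('X - a2%:P) * intpoly2 - (c2 * b1) *: 'X.
Definition intpoly4 : {poly F} :=
  ('X - a3%:P) * intpoly3 - (c3 * b2) *: intpoly2.
(** The cubic whose value at A is the distance matrix. *)
Definition distpoly : {poly F} :=
  'X + (2 / c2) *: intpoly2 + (3 / (c2 * c3)) *: intpoly3.

Hypotheses (c2_neq0 : c2 != 0) (c3_neq0 : c3 != 0).
Hypotheses (sum1 : k = 1 + a1 + b1) (sum2 : k = c2 + a2 + b2)
  (sum3 : k = c3 + a3).

Lemma horner_intpoly2 x : intpoly2.[x] = x ^+ 2 - a1 * x - k.
Proof. by rewrite /intpoly2 !hornerE. Qed.

Lemma horner_intpoly3 x :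
  intpoly3.[x] = (x - a2) * intpoly2.[x] - c2 * b1 * x.
Proof.
by rewrite /intpoly3 !(hornerD, hornerN, hornerZ, hornerM, hornerX, hornerC).
Qed.

Lemma horner_intpoly4 x :
  intpoly4.[x] = (x - a3) * intpoly3.[x] - c3 * b2 * intpoly2.[x].
Proof.
by rewrite /intpoly4 !(hornerD, hornerN, hornerZ, hornerM, hornerX, hornerC).
Qed.

Lemma horner_distpoly x :
  distpoly.[x] = x + 2 / c2 * intpoly2.[x] + 3 / (c2 * c3) * intpoly3.[x].
Proof. by rewrite /distpoly !(hornerD, hornerZ, hornerX). Qed.

(** The second factor is c2 c3 times the polynomial that takes the value
    A_0 + A_1 + A_2 + A_3, the all-one matrix J, at A.  The identity is the
    polynomial form of J A = k J: summing the recurrence, the coefficients of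
    each A_i add up to k. *)
Lemma intpoly4_telescope x :
  (x - k) * (c2 * c3 * (1 + x) + c3 * intpoly2.[x] + intpoly3.[x])
    = intpoly4.[x].
Proof.
rewrite horner_intpoly4 horner_intpoly3 horner_intpoly2.
have -> : b1 = k - 1 - a1 by rewrite sum1; ring.
have -> : b2 = k - c2 - a2 by rewrite sum2; ring.
have -> : a3 = k - c3 by rewrite sum3; ring.
ring.
Qed.

(** On a nontrivial eigenspace J is zero, so D may be replaced by
    D - 3 J = - 3 I - 2 A - A_2, which is quadratic in A. *)
Lemma distpoly_nontrivial x : x != k -> root intpoly4 x ->
  distpoly.[x] = - 3 - 2 * x - intpoly2.[x] / c2.
Proof.
rewrite -subr_eq0 => xk; rewrite rootE -intpoly4_telescope mulf_eq0 (negbTE xk) /=.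
move=> /eqP sum0; have -> : distpoly.[x] =
    3 * ((c2 * c3 * (1 + x) + c3 * intpoly2.[x] + intpoly3.[x]) / (c2 * c3))
    - 3 - 2 * x - intpoly2.[x] / c2.
  rewrite horner_distpoly; field.
  by rewrite c2_neq0 c3_neq0.
by rewrite sum0 mul0r mulr0 add0r.
Qed.

(** Both values come from one quadratic, which takes equal values at two
    distinct points exactly when these are symmetric about its axis. *)
Lemma distpoly_eq x y : x != k -> y != k -> x != y ->
    root intpoly4 x -> root intpoly4 y ->
  (distpoly.[x] == distpoly.[y]) = (x + y == a1 - 2 * c2).
Proof.
move=> xk yk xy Px Py; rewrite !distpoly_nontrivial // -subr_eq0.
have -> : - 3 - 2 * x - intpoly2.[x] / c2 - (- 3 - 2 * y - intpoly2.[y] / c2)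
    = (y - x) * ((x + y - (a1 - 2 * c2)) / c2).
  by rewrite !horner_intpoly2; field.
by rewrite !mulf_eq0 invr_eq0 (negbTE c2_neq0) orbF !subr_eq0 eq_sym (negbTE xy).
Qed.

(** The expanded form gives access to the cubic coefficient. *)
Lemma intpoly4E : intpoly4 = Poly [::
  a3 * a2 * (- k) + c3 * b2 * k;
  (a3 + a2) * k - a3 * a2 * a1 + a3 * c2 * b1 + c3 * b2 * a1;
  - k + (a3 + a2) * a1 + a3 * a2 - c2 * b1 - c3 * b2;
  - (a1 + a2 + a3); 1].
Proof.
rewrite /= !cons_poly_def /intpoly4 /intpoly3 /intpoly2 -!mul_polyC.
rewrite !(polyCD, polyCN, polyCM, polyC1, polyC0) mul0r add0r.
by ring.
Qed.

Section Matrices.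
Variables (n : nat) (A A2 A3 : 'M[F]_n).
Hypotheses (AA : A *m A = c2 *: A2 + a1 *: A + k%:M)
  (A2A : A2 *m A = c3 *: A3 + a2 *: A2 + b1 *: A)
  (A3A : A3 *m A = a3 *: A3 + b2 *: A2).

Lemma three_class_spectrum (th1 th2 th3 : F) :
    uniq [:: k; th1; th2; th3] ->
    {in [:: k; th1; th2; th3], forall z, eigenvalue A z} ->
  [/\ all (root intpoly4) [:: k; th1; th2; th3],
      th1 + th2 + th3 = a1 + a2 + a3 - k,
      forall x, eigenvalue (A + 2 *: A2 + 3 *: A3) x
        = (x \in [seq distpoly.[z] | z <- [:: k; th1; th2; th3]])
    & forall (v : 'rV_n) z, v *m A = z *: v ->
        v *m (A + 2 *: A2 + 3 *: A3) = distpoly.[z] *: v].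
Proof.
case: n A A2 A3 AA A2A A3A => [|m] B B2 B3 BB B2B B3B s_uniq sP.
  (* Evaluation of polynomials at matrices requires a positive size; matrices
     of size 0 have no eigenvalue. *)
  have /eigenvalueP[v _] := sP k (mem_head _ _).
  by rewrite [v]thinmx0 eqxx.
have hornerXsub c : horner_mx B ('X - c%:P) = B - c%:M.
  by rewrite rmorphB /= horner_mx_X horner_mx_C.
have u2 : horner_mx B intpoly2 = c2 *: B2.
  rewrite /intpoly2 !rmorphB /= rmorphXn horner_mxZ /= horner_mx_X horner_mx_C expr2.
  by rewrite -[B * B]/(B *m B) BB addrAC !addrK.
have u3 : horner_mx B intpoly3 = (c2 * c3) *: B3.
  rewrite /intpoly3 rmorphB [_ * intpoly2]mulrC rmorphM /= horner_mxZ hornerXsub.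
  rewrite u2 horner_mx_X -[_ * _]/(_ *m _) mulmxBr -!scalemxAl B2B.
  by rewrite mul_mx_scalar; apply/matrixP=> i j; rewrite !mxE; ring.
have u4 : horner_mx B intpoly4 = 0.
  rewrite /intpoly4 rmorphB [_ * intpoly3]mulrC rmorphM /= horner_mxZ hornerXsub.
  rewrite u2 u3 -[_ * _]/(_ *m _) mulmxBr -!scalemxAl B3B.
  by rewrite mul_mx_scalar; apply/matrixP=> i j; rewrite !mxE; ring.
have qE : B + 2 *: B2 + 3 *: B3 = horner_mx B distpoly.
  rewrite /distpoly !rmorphD /= !horner_mxZ /= u2 u3 horner_mx_X !scalerA.
  by rewrite !mulfVK // mulf_neq0.
have roots : all (root intpoly4) [:: k; th1; th2; th3].
  apply/allP=> z /sP; rewrite eigenvalue_root_min -!dvdp_XsubCl => zB.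
  exact: dvdp_trans zB (mxminpoly_min u4).
have [prodE sumE] : intpoly4 = \prod_(z <- [:: k; th1; th2; th3]) ('X - z%:P)
    /\ \sum_(z <- [:: k; th1; th2; th3]) z = - - (a1 + a2 + a3).
  by rewrite intpoly4E; apply: monic_quartic_roots; rewrite // -intpoly4E.
split=> //.
- rewrite !big_cons big_nil in sumE.
  by rewrite -[a1 + _ + _]opprK -sumE; ring.
- by rewrite qE; apply: eigenvalue_horner_mx; rewrite -?prodE.
by move=> v z vB; rewrite qE; apply: mulmx_horner_eigen.
Qed.
End Matrices.
End ThreeClass.

Theorem corollary3p7 (R : rcfType) (V : finType) (e : rel V)
  (e_sym : symmetric e) (e_irr : irreflexive e)
  (n : nat) (card_V : #|V| = n)
  (k b1 b2 c2 c3 : nat)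
  (e_dr : distance_regular e)
  (e_diam : diameter e = 3%N)
  (e_array : intersection_array e [:: k; b1; b2] [:: 1%N; c2; c3])
  (theta1 theta2 theta3 : R)
  (theta_sorted : [/\ theta1 < k%:R, theta2 < theta1 & theta3 < theta2])
  (theta_spec : forall x : R,
     eigenvalue (adjacency_mx R e) x
       = (x \in [:: k%:R; theta1; theta2; theta3]))
  (a3 : R) (a3E : a3 = k%:R - c3%:R) :
  num_distinct_eigenvalues (distance_mx R e) 3 <->
  c2%:R + a3 - b2%:R \in [:: theta1; theta2; theta3].
Proof.
case: e_dr => e_conn _; case: e_array => a [b [c [abc]]].
rewrite e_diam => -[kE b1E b2E] [c1E c2E c3E].
have [x1 [y1 d1]] := @dist_attained V e e_conn 1%N ltac:(lia) ltac:(lia).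
have [x2 [y2 d2]] := @dist_attained V e e_conn 2%N ltac:(lia) ltac:(lia).
have [x3 [y3 d3]] := @dist_attained V e e_conn 3%N ltac:(lia) ltac:(lia).
have sum1 := intersection_sum e_sym e_irr e_conn abc d1.
have sum2 := intersection_sum e_sym e_irr e_conn abc d2.
have sum3 := intersection_sum e_sym e_irr e_conn abc d3.
have b3 : b 3%N = 0%N.
  by rewrite -e_diam (b_diameter abc (x := x3) (y := y3)) ?e_diam.
have c2_neq0 : c2%:R != 0 :> R.
  by rewrite pnatr_eq0 c2E -lt0n (c_gt0 e_sym e_conn abc d2).
have c3_neq0 : c3%:R != 0 :> R.
  by rewrite pnatr_eq0 c3E -lt0n (c_gt0 e_sym e_conn abc d3).
have natE m p : m = p -> m%:R = p%:R :> R by move->.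
have {}sum1 : k%:R = 1 + (a 1%N)%:R + b1%:R :> R.
  by rewrite -[1]/(1%:R) -!natrD; apply: natE; lia.
have {}sum2 : k%:R = c2%:R + (a 2%N)%:R + b2%:R :> R.
  by rewrite -!natrD; apply: natE; lia.
have {}sum3 : k%:R = c3%:R + (a 3%N)%:R :> R.
  by rewrite -!natrD; apply: natE; lia.
set A := adjacency_mx R e in theta_spec *.
pose A2 := dist_class_mx e R 2%N; pose A3 := dist_class_mx e R 3%N.
have AA : A *m A = c2%:R *: A2 + (a 1%N)%:R *: A + k%:R%:M.
  have A1 : dist_class_mx e R 1%N = A by apply: dist_class_mx1.
  rewrite -{1}A1 (dist_class_mxMA e_sym e_conn abc).
  by rewrite A1 dist_class_mx0 // -c2E -kE scalemx1.
have A2A : A2 *m A = c3%:R *: A3 + (a 2%N)%:R *: A2 + b1%:R *: A.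
  rewrite (dist_class_mxMA e_sym e_conn abc).
  by rewrite dist_class_mx1 // -c3E -b1E.
have A3A : A3 *m A = (a 3%N)%:R *: A3 + b2%:R *: A2.
  rewrite (dist_class_mxMA e_sym e_conn abc) dist_class_mx_gt_diameter ?e_diam //.
  by rewrite scaler0 add0r -b2E.
have [t1k t21 t32] := theta_sorted.
have [t2k t31] := (lt_trans t21 t1k, lt_trans t32 t21).
have t3k := lt_trans t31 t1k.
have s_uniq : uniq [:: k%:R; theta1; theta2; theta3].
  by rewrite /= !inE !negb_or !gt_eqF //.
have sP : {in [:: k%:R; theta1; theta2; theta3], forall z, eigenvalue A z}.
  by move=> z; rewrite theta_spec.
have [roots sumE spec eigv] :=
  three_class_spectrum c2_neq0 c3_neq0 AA A2A A3A s_uniq sP.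
rewrite -(distance_mxE e_irr e_conn R e_diam) in spec eigv.
set q := distpoly _ _ _ _ _ _ in spec eigv.
(* The eigenvectors of D for q(k) are constant, hence eigenvectors of A for
   k only. *)
have qk z : z \in [:: theta1; theta2; theta3] -> (q.[k%:R] == q.[z]) = false.
  move=> zs; apply/negP=> /eqP qz.
  have /eigenvalueP[v vA v_neq0] : eigenvalue A z by rewrite theta_spec inE zs orbT.
  have [|||r vE] := @Perron_constant R _ (distance_mx R e) q.[k%:R] v.
  - move=> i j ij; rewrite mxE ltr0n lt0n dist_eq0 //.
    by rewrite (inj_eq enum_val_inj).
  - by apply: eigv; rewrite (const_mxMA e_sym e_irr e_conn abc) -kE.
  - by rewrite qz; apply: eigv.
  have : (z - k%:R) *: v == 0.
    rewrite scalerBl -vA vE -scalemxAl.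
    by rewrite (const_mxMA e_sym e_irr e_conn abc) -kE !scalerA mulrC subrr.
  rewrite scaler_eq0 (negbTE v_neq0) orbF subr_eq0 => /eqP zk.
  by move: s_uniq; rewrite -zk /= zs.
(* Two nontrivial values of q coincide exactly when the third theta is the
   given number. *)
have pairE x y z : x \in [:: theta1; theta2; theta3] ->
    y \in [:: theta1; theta2; theta3] -> x != y ->
    x + y + z = theta1 + theta2 + theta3 ->
    (q.[x] == q.[y]) = (c2%:R + a3 - b2%:R == z).
  move=> xs ys xy xyz.
  have neq_k u : u \in [:: theta1; theta2; theta3] -> u != k%:R.
    by apply: contraTneq => ->; case/andP: s_uniq.
  have in_spec u : u \in [:: theta1; theta2; theta3] ->
      u \in [:: k%:R; theta1; theta2; theta3].
    by move=> us; rewrite inE us orbT.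
  rewrite (distpoly_eq c2_neq0 c3_neq0 sum1 sum2 sum3) ?neq_k //;
    try by apply: (allP roots); apply: in_spec.
  rewrite -subr_eq0 -[RHS]subr_eq0; congr (_ == 0).
  by rewrite a3E; lra.
rewrite /num_distinct_eigenvalues (num_distinct_undup _ spec).
rewrite /= !inE !qk ?inE ?eqxx ?orbT //=.
rewrite (pairE theta1 theta2 theta3) ?(pairE theta1 theta3 theta2)
  ?(pairE theta2 theta3 theta1) ?inE ?eqxx ?orbT
  ?(gt_eqF t21) ?(gt_eqF t31) ?(gt_eqF t32) //; try by ring.
(* As the thetas are distinct, at most one of the three coincidences occurs. *)
set t := _ - b2%:R.
have [->|_] := eqVneq t theta1.
  by rewrite (gt_eqF t21) (gt_eqF t31).
have [->|_] := eqVneq t theta2.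
  by rewrite (gt_eqF t32).
by case: (t == theta3).
Qed.
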